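(* Let $G$ be a finite group. If $o(G)<\frac{31}{12}$, then $G$ is supersolvable. Moreover, $o(G)=\frac{31}{12}$ if and only if $G\cong A_4$.
   Context: For a finite group $G$, $\psi(G)=\sum_{x\in G}o(x)$ denotes the sum of the orders $o(x)$ of the elements $x$ of $G$, and $o(G)=\frac{\psi(G)}{|G|}$ denotes the average order of $G$. $A_4$ is the alternating group of degree $4$. *)

(* Defs.v *)
From mathcomp Require Import all_boot all_order all_algebra all_fingroup all_solvable.

Set Implicit Arguments.
Unset Strict Implicit.
Unset Printing Implicit Defensive.

Import Order.TTheory GRing.Theory Num.Theory GroupScope.

Section Defs.

Variable gT : finGroupType.

Definition psi (G : {set gT}) : nat := (\sum_(x in G) #[x])%N.

Definition avg_order (G : {set gT}) : rat := ((psi G)%:R / #|G|%:R)%R.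

(* V and U are normal in the whole group A, not just V in U: this is what
   separates supersolvable from polycyclic. *)
Definition cyclic_normal_factor (A V U : {set gT}) : bool :=
  [&& V <| A, U <| A, V \subset U & cyclic (U / V)].

Definition supersolvable (G : {group gT}) : Prop :=
  exists2 s : seq {group gT},
    (cyclic_normal_factor G).-series 1%G s & last 1%G s = G.

End Defs.

(* Main.v *)
Require Import Defs.
From mathcomp Require Import all_boot all_order all_algebra all_fingroup all_solvable.
From mathcomp Require Import all_field all_character zify ring.

Set Implicit Arguments.
Unset Strict Implicit.
Unset Printing Implicit Defensive.

Import GroupScope.

(** Why the theorem is true.  Write n for the order of G, assume
    12 psi(G) <= 31 n, and argue by induction on n.

    An element that is not a solution of x^2 = 1 has order at least 3, so a small
    average order forces many solutions: if t is their number, then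
    5n <= 12(t + 1) ([card_le_psi_involutory]).

    Many solutions force solvability.  If x and y are solutions with xy = g then
    x inverts g, so for given g the number of such pairs is at most |C(g)|.
    Hence t^2 is at most the number of commuting pairs
    ([sqr_card_involutory_le]).  The proportion of commuting pairs does not
    decrease when G is replaced by a normal subgroup or by a quotient, so for
    nonsolvable G it is bounded by its value on some nonabelian simple group H,
    which is k(H)/|H|.  A nontrivial irreducible character of H has degree at
    least 3 ([simple_irr_degree_ge3]), and |H| >= 30 because three primes
    divide |H|; this makes the proportion at most 19/135, which contradicts
    5n <= 12(t + 1) ([solvable_of_involutory]).

    So a minimal normal subgroup V is elementary abelian.  If V is cyclic, then it
    has prime order, psi(G/V) |V| < psi(G), and induction applies to G/V.
    If V is not cyclic, then some y in G is such that y^2 acts nontrivially on V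
    ([minnormal_noncyclic_square]).  Counting coset by coset of V gives 3t <= n when
    V has odd order ([odd_minnormal_involutory]), which is impossible.  When V is
    a 2-group with centraliser C it gives 3n <= psi(G) + |C| + 1
    ([psi_ge_of_abelem2]), and together with 3|C| <= n this leaves only n = 12 and
    C = V of order 4, the case of A_4.

    The outcome ([psi_le_dichotomy]) is that G is either a group of order 12 with
    four Sylow 3-subgroups, for which psi(G) = 31 and G is isomorphic to A_4, or a
    supersolvable group with a normal 2-complement K.  To exclude equality in the
    second case, note that psi(G) is odd: x and x^-1 have the same order.  So
    12 psi(G) = 31 n gives |G : K| = 4 and K is not trivial.  At most two of the three
    nontrivial cosets of K can consist of involutions, the others containing at
    most |K|/3 of them, and elements outside K that are not involutions have large
    order; so psi(G) is too large ([psi_normal_2complement_gt]). *)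

(** * Solutions of x^2 = 1 and commuting pairs *)

Section CommutingPairs.
Variable gT : finGroupType.
Implicit Types (G H K N V : {group gT}) (x v : gT).

Definition involutory G := [set x in G | x ^+ 2 == 1].

Definition commuting_pairs G := (\sum_(x in G) #|'C_G[x]|)%N.

Lemma sqr_mulg x v : (x * v) ^+ 2 = x ^+ 2 * (v ^ x * v).
Proof. by rewrite !expgS !expg0 !mulg1 conjgE !mulgA mulgK. Qed.

Lemma invg_id_of_sqr x : x ^+ 2 = 1 -> x^-1 = x.
Proof. by move=> x2; apply: (mulgI x); rewrite mulgV -x2 expgS expg1. Qed.

Lemma order_eq2 (x : gT) : x != 1 -> x ^+ 2 = 1 -> #[x] = 2%N.
Proof.
move=> ntx x2; apply: nt_prime_order => //.
Qed.

Lemma order_ge3 x : x ^+ 2 != 1 -> (3 <= #[x])%N.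
Proof.
move=> x2; rewrite ltnNge; apply: contra x2 => le2.
have := expg_order x; have := order_gt0 x.
by case: #[x] le2 => [|[|[|]]] //= _ _ xo; rewrite ?xo // expgS xo mulg1 -[x]expg1 xo.
Qed.

Lemma order_ge4 x : x ^+ 2 != 1 -> x ^+ 4 = 1 -> (4 <= #[x])%N.
Proof.
move=> x2 x4; rewrite leq_eqVlt; apply/orP; left; rewrite eq_sym.
have: #[x] %| 4 by rewrite order_dvdn x4.
have := order_ge3 x2; move: #[x] => n le3 dv.
have := @dvdn_leq n 4 isT dv; by case: n le3 dv => [|[|[|[|[|]]]]].
Qed.

(** The solutions of x^2 = 1 are the identity, of order 3 - 2, and the involutions,
    of order 3 - 1; all other elements have order at least 3. *)
Lemma card_le_psi_involutory G : (3 * #|G| <= psi G + #|involutory G| + 1)%N.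
Proof.
rewrite /psi -[#|involutory G|]sum1_card (big_setID [set 1]) /=.
have -> : G :&: [set 1] = [set 1].
  by apply/setP=> x; rewrite !inE andbC; case: eqP => // ->; rewrite group1.
have -> : (\sum_(i in involutory G) 1
           = 1 + \sum_(x in G :\ 1%g) (x ^+ 2 == 1%g)%g)%N.
  rewrite (bigD1 (1 : gT)) /=; last by rewrite !inE group1 expg1n eqxx.
  congr addn; rewrite big_mkcond [RHS]big_mkcond; apply: eq_bigr => x _.
  by rewrite !inE; case: (x \in G) => //=; case: (x == 1); case: (x ^+ 2 == 1).
rewrite big_set1 order1.
have: (\sum_(x in G :\ 1%g) 3 <= \sum_(x in G :\ 1%g) (#[x] + (x ^+ 2 == 1)%g))%N.
  apply: leq_sum => x /setD1P[ntx _]; case: eqP => [x2 | x2].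
    by rewrite (order_eq2 ntx x2).
  by rewrite addn0 order_ge3 //; apply/eqP.
rewrite big_split sum_nat_const /= (cardsD1 1 G) group1 add1n.
by set a := bigop _ _ _; set b := bigop _ _ _; move: #|_| a b => *; lia.
Qed.

Lemma commuting_pairsE G : commuting_pairs G = (#|classes G| * #|G|)%N.
Proof.
have actsG: [acts G, on G | 'J] by apply/actsP=> x Gx y; apply: groupJr.
rewrite /commuting_pairs /classes -(Frobenius_Cauchy actsG).
by apply: eq_bigr => x _; rewrite afixJ cent_set1.
Qed.

(** If x and y are solutions of z^2 = 1 with product g, then x inverts g. Two
    elements that invert g differ by an element of the centraliser of g, so at most
    |C(g)| of the pairs (x, y) have product g. *)
Lemma sqr_card_involutory_le G : (#|involutory G| ^ 2 <= commuting_pairs G)%N.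
Proof.
set I := involutory G.
have IP x : x \in I -> x \in G /\ x^-1 = x.
  by rewrite inE => /andP[Gx /eqP x2]; split; last exact: invg_id_of_sqr.
have -> : (#|I| ^ 2 = \sum_(x in I) \sum_(y in I) 1)%N.
  by rewrite !sum_nat_const muln1 mulnn.
have -> : (\sum_(x in I) \sum_(y in I) 1
           = \sum_(x in I) \sum_(g in G | (g * x^-1)%g \in I) 1)%N.
  apply: eq_bigr => x /IP[Gx _].
  (* The pair (x, y) is recorded as (x, g) with g = y x. *)
  rewrite (reindex_inj (mulIg x^-1)) /=.
  apply: eq_bigl => g; apply/idP/andP=> [Igx | [] //]; split=> //.
  by case/IP: Igx => Ggx _; rewrite -(groupMr _ (groupVr Gx)).
rewrite (exchange_big_dep [in G]) //=; last by move=> x g _ /andP[].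
apply: leq_sum => g Gg; rewrite sum1_card.
have [x0 /andP[/IP[Gx0 x0V] /andP[_ /IP[_ gx0]]] | no] :=
  pickP [pred x | (x \in I) && ((g \in G) && (g * x^-1 \in I))]; last first.
  by rewrite eq_card0 //; move=> x; rewrite -[RHS](no x).
have invg x : x^-1 = x -> (g * x^-1)^-1 = g * x^-1 -> g ^ x = g^-1.
  move=> xV; rewrite invMg invgK => e.
  by rewrite conjgE -{2}xV -e mulKg.
rewrite -(card_lcoset 'C_G[g] x0); apply: subset_leq_card; apply/subsetP=> x.
case/andP=> /IP[Gx xV] /andP[_ /IP[_ gx]].
rewrite mem_lcoset inE groupM ?groupV //= cent1C; apply/cent1P/commgP/conjg_fixP.
by rewrite conjgM x0V (invg _ x0V gx0) conjVg (invg _ xV gx) invgK.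
Qed.

Lemma cent1_card_normal G N x :
  N <| G -> (#|'C_G[x]| <= #|G : N| * #|'C_N[x]|)%N.
Proof.
case/andP=> sNG nNG.
have -> : 'C_N[x] = 'C_G[x] :&: N by rewrite setIAC (setIidPr sNG).
rewrite -(LagrangeI 'C_G[x] N) mulnC leq_mul2r; apply/orP; right.
have nNC: 'C_G[x] \subset 'N(N) by apply: subset_trans (subsetIl _ _) nNG.
by rewrite -!card_quotient // subset_leq_card ?quotientS ?subsetIl.
Qed.

(** Of a commuting pair, each entry is replaced in turn by an element of N, which
    costs a factor |G : N| each time; symmetry of the relation allows the swap in
    between. *)
Lemma commuting_pairs_normal G N :
  N <| G -> (commuting_pairs G <= #|G : N| ^ 2 * commuting_pairs N)%N.
Proof.
move=> nsNG; have sNG := normal_sub nsNG.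
have swap H K : (\sum_(x in H) #|'C_K[x]| = \sum_(y in K) #|'C_H[y]|)%N.
  transitivity (\sum_(x in H) \sum_(y in K | (x * y == y * x)%g) 1)%N.
    apply: eq_bigr => x _; rewrite sum1_card; apply: eq_card => y.
    by rewrite inE cent1C; congr (_ && _); apply/cent1P/eqP.
  rewrite (exchange_big_dep [in K]) //=; last by move=> x y _ /andP[].
  apply: eq_bigr => y Ky; rewrite sum1_card; apply: eq_card => x.
  by rewrite inE [_ \in _]/= Ky; congr (_ && _); apply/eqP/cent1P.
apply: leq_trans (_ : \sum_(x in G) #|G : N| * #|'C_N[x]| <= _)%N.
  by apply: leq_sum => x _; apply: cent1_card_normal.
rewrite -big_distrr /= swap expnS expn1 -mulnA leq_mul2l; apply/orP; right.
rewrite [leqRHS]big_distrr /=; apply: leq_sum => x _.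
exact: cent1_card_normal.
Qed.

End CommutingPairs.

(** The image of the centraliser of x centralises the image of x, and each coset of
    N has |N| elements x. *)
Lemma commuting_pairs_quotient (gT : finGroupType) (G N : {group gT}) :
  N <| G -> (commuting_pairs G <= #|N| ^ 2 * commuting_pairs (G / N))%N.
Proof.
move=> nsNG; have [sNG nNG] := andP nsNG.
have step x : x \in G -> (#|'C_G[x]| <= #|N| * #|'C_(G / N)[coset N x]|)%N.
  move=> Gx; have nNC: 'C_G[x] \subset 'N(N) by apply: subset_trans (subsetIl _ _) nNG.
  rewrite -(LagrangeI 'C_G[x] N) leq_mul ?subset_leq_card ?subsetIr //.
  rewrite -card_quotient // subset_leq_card //.
  by apply: subset_trans (quotientI _ _ _) _; rewrite setIS // quotient_cent1.
apply: leq_trans (_ : \sum_(x in G) #|N| * #|'C_(G / N)[coset N x]| <= _)%N.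
  exact: leq_sum.
rewrite -big_distrr /= expnS expn1 -mulnA.
rewrite leq_mul2l; apply/orP; right.
rewrite (partition_big (coset N) [in G / N]) /=; last first.
  by move=> x Gx; rewrite mem_quotient.
rewrite big_distrr /=; apply: leq_sum => _ /morphimP[x Nx Gx ->] /=.
rewrite (eq_bigr (fun _ => #|'C_(G / N)[coset N x]|)); last by move=> y /andP[_ /eqP->].
rewrite sum_nat_const leq_mul2r; apply/orP; right.
rewrite -(card_rcoset N x); apply: subset_leq_card; apply/subsetP=> y.
case/andP=> Gy /eqP e; apply/rcoset_kercosetP => //.
exact: (subsetP nNG).
Qed.

(** * Commuting pairs in nonsolvable groups *)

Section InvolutiveMatrix.
Import GRing.Theory Num.Theory.
Local Open Scope ring_scope.
(** By the Cayley-Hamilton identity A^2 - (tr A) A + det A = 0, the hypotheses give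
    (tr A) A = 2; hence the trace is not zero and A is scalar. *)
Lemma involutive_det1_scalar (A : 'M[algC]_2) :
  A *m A = 1%:M -> \det A = 1 -> is_scalar_mx A.
Proof.
move=> A2 detA.
have e i j : (A *m A) i j = (i == j)%:R by rewrite A2 mxE.
have := e 0 0; have := e 0 1; have := e 1 0; have := e 1 1.
rewrite !mxE !big_ord_recl !big_ord0 /= !addr0.
have lift01 : lift ord0 ord0 = 1 :> 'I_2 by apply: val_inj.
rewrite lift01 => d2 c2 b2 a2.
move: detA; rewrite (expand_det_row _ 0) !big_ord_recl big_ord0 /cofactor !det_mx11 !mxE.
have lift10 : lift 1 0 = 0 :> 'I_2 by apply: val_inj.
rewrite lift01 lift10 addr0 /= expr0 expr1 mul1r => dA.
move: d2 c2 b2 a2 dA; rewrite /ord0.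
set a := A 0 0; set b := A 0 1; set c := A 1 0; set d := A 1 1.
move=> d2 c2 b2 a2 dA.
have {}a2 : a * a + b * c = 1 := a2.
have {}b2 : a * b + b * d = 0 := b2.
have {}c2 : c * a + d * c = 0 := c2.
have {}d2 : c * b + d * d = 1 := d2.
have tr2 : (a + d) * a = 2%:R by rewrite -[2%:R]/(1 + 1) -{1}a2 -dA /=; ring.
have tr0 : a + d != 0.
  by apply: contra_eq_neq tr2 => ->; rewrite mul0r eq_sym pnatr_eq0.
have ad : a = d.
  by apply: (mulfI tr0); rewrite tr2 -[2%:R]/(1 + 1) -{1}d2 -dA /=; ring.
have b0 : b = 0 by apply: (mulfI tr0); rewrite mulr0 -b2; ring.
have c0 : c = 0 by apply: (mulfI tr0); rewrite mulr0 -c2; ring.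
apply/is_scalar_mxP; exists a; apply/matrixP=> i j; rewrite mxE.
by case: i j => [[|[|//]] ?] [[|[|//]] ?] /=;
  rewrite ?mulr1n ?mulr0n; [| rewrite -b0 | rewrite -c0 | rewrite ad];
  congr (A _ _); apply: val_inj.
Qed.
End InvolutiveMatrix.

Section SimpleGroup.
Import GRing.Theory Num.Theory.
Local Open Scope ring_scope.
Variable gT : finGroupType.
Implicit Types (G H : {group gT}).

(** H is perfect, so its only linear character is trivial. If there were an
    irreducible character of degree 2, then H would have even order. An involution
    of H would be represented by a matrix of determinant 1, because the determinant
    is a linear character, hence by a scalar. The representation being faithful, the
    involution would lie in the trivial centre of H. *)
Lemma simple_irr_degree_ge3 H (i : Iirr H) :
  simple H -> ~~ abelian H -> i != 0%R ->
  (2 < irr_degree (socle_of_Iirr i))%N.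
Proof.
move=> simH nabH nti; have [ntH normH] := simpleP _ simH.
have fful: cfker 'chi_i = 1%g.
  have [//|/= kerH] := normH [group of cfker 'chi_i] (cfker_normal _).
  by rewrite -(subGcfker i) kerH subxx in nti.
have derH: H^`(1)%g = H.
  have [|//] := normH [group of H^`(1)%g] (der_normal 1 H).
  by move/derG1P => abH; rewrite abH in nabH.
have lin_triv : forall j, 'chi[H]_j \is a linear_char -> j = 0%R.
  by move=> j; rewrite lin_irr_der1 derH subGcfker => /eqP.
have deg_gt0 := irr_degree_gt0 (socle_of_Iirr i).
rewrite ltnNge; apply/negP=> deg_le2.
have /orP[/eqP deg1|/eqP deg2] : (irr_degree (socle_of_Iirr i) == 1%N)
    || (irr_degree (socle_of_Iirr i) == 2%N).
- by move: deg_gt0 deg_le2; case: irr_degree => [|[|[|]]].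
- case/eqP: nti; apply: lin_triv.
  by rewrite qualifE /= irr_char irr1_degree deg1 /=.
have: (2 %| #|H|)%N.
  by have:= dvd_irr1_cardG i; rewrite irr1_degree dvdC_nat deg2.
case/Cauchy=> // x Hx ox.
have x2 : (x * x)%g = 1%g by rewrite -[RHS](expg_order x) ox expgS expg1.
suff: x \in 'Z(H).
  have [-> | ZH] := normH 'Z(H)%G (center_normal H).
    by move/set1P=> x1; rewrite x1 order1 in ox.
  by case/negP: nabH; apply/center_idP.
rewrite -(cfcenter_fful_irr (i := i)); last by rewrite cfaithfulE fful.
rewrite -irrRepr cfcenter_repr inE Hx /=.
suff scal n (rG : mx_representation algC H n) : n = 2%N -> is_scalar_mx (rG x).
  exact: scal deg2.
move=> n2; subst n.
apply: involutive_det1_scalar.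
  by rewrite -repr_mxM // x2 repr_mx1.
have linD := detRepr_lin_char rG.
have [j Dj] := irrP (lin_char_irr linD).
have j0 : j = 0%R by apply: lin_triv; rewrite -Dj.
have := congr1 (fun f : 'CF(H) => f x) Dj; rewrite /= j0 irr0 cfun1E Hx.
by rewrite /detRepr cfunE Hx mulr1n trace_mx11 mxE mulr1n.
Qed.
End SimpleGroup.

(** The degrees of the k irreducible characters satisfy |H| = 1 + (sum of the
    squares of the k - 1 nontrivial degrees) >= 1 + 9(k - 1). *)
Lemma simple_nonabelian_class_count (gT : finGroupType) (H : {group gT}) :
  simple H -> ~~ abelian H -> (9 * #|classes H| <= #|H| + 8)%N.
Proof.
move=> simH nabH.
have sumsq: (\sum_(i : Iirr H) irr_degree (socle_of_Iirr i) ^ 2 = #|H|)%N.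
  apply/eqP; rewrite -eqC_nat -irr_sum_square GRing.natr_sum; apply/eqP.
  by apply: eq_bigr => i _; rewrite irr1_degree GRing.natrX.
have deg0: irr_degree (socle_of_Iirr (0%R : Iirr H)) = 1%N.
  by apply/eqP; rewrite -eqC_nat -irr1_degree irr0 cfun11.
have: (\sum_(i : Iirr H | i != 0%R) 9
       <= \sum_(i : Iirr H | i != 0%R) irr_degree (socle_of_Iirr i) ^ 2)%N.
  apply: leq_sum => i nti.
  by rewrite (@leq_exp2r 3 _ 2) // simple_irr_degree_ge3.
rewrite sum_nat_const => le9; rewrite -sumsq (bigD1 0%R) //= deg0.
have nti: #|[pred i : Iirr H | i != 0%R]| = #|classes H|.-1.
  by rewrite -NirrE (cardC1 (0%R : Iirr H)) card_ord.
have k_gt0: (0 < #|classes H|)%N by rewrite -NirrE.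
by move: le9 k_gt0; rewrite nti; set s := bigop _ _ _; move: #|_| s => k s; lia.
Qed.

(** The product of the three smallest primes is 30, and a group whose order has at
    most two prime divisors is solvable by the theorem of Burnside. *)
Lemma nonsolvable_card_ge30 (gT : finGroupType) (H : {group gT}) :
  ~~ solvable H -> (30 <= #|H|)%N.
Proof.
apply: contraR; rewrite -ltnNge => lt30; apply: Burnside_p_a_q_b.
have: all (fun n => (size (primes n) <= 2)%N) (iota 0 30) by [].
by move/allP; apply; rewrite mem_iota.
Qed.

(** For a simple group the proportion of commuting pairs is k/|H|, which is at most
    1/9 + 8/(9|H|) <= 1/9 + 8/270 = 19/135. A nonsolvable group that is not simple
    has a nonsolvable proper normal subgroup or a nonsolvable proper quotient, with
    a proportion at least as large. *)
Lemma commuting_pairs_nonsolvable (gT : finGroupType) (G : {group gT}) :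
  ~~ solvable G -> (135 * commuting_pairs G <= 19 * #|G| ^ 2)%N.
Proof.
have [n] := ubnP #|G|; elim: n => // n IHn in gT G * => /ltnSE leGn nsolG.
have ntG: G :!=: 1 by apply: contra nsolG => /eqP->; apply: solvable1.
have [N minN sNG] := minnormal_exists ntG (normG G).
have /andP[ntN nNG] := mingroupp minN.
have nsNG: N <| G by apply/andP.
have [defN | ltNG] := eqVproper sNG.
  have simG: simple G by rewrite /simple -[in X in minnormal X _]defN.
  have nabG: ~~ abelian G by apply: contra nsolG; apply: abelian_sol.
  have := simple_nonabelian_class_count simG nabG.
  have := nonsolvable_card_ge30 nsolG.
  rewrite commuting_pairsE => ge30 le9; rewrite -mulnn !mulnA.
  by rewrite leq_mul2r; apply/orP; right; move: ge30 le9; move: #|_| #|G| => *; lia.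
have bound p q a b c h : (c <= a ^ 2 * b)%N -> (p * b <= q * h ^ 2)%N ->
    (p * c <= q * (a * h) ^ 2)%N.
  move=> le_c le_b; rewrite expnMn mulnCA.
  apply: leq_trans (_ : a ^ 2 * (p * b) <= _)%N; last by rewrite leq_mul2l le_b orbT.
  by rewrite mulnCA leq_mul2l le_c orbT.
have [solN | nsolN] := boolP (solvable N); last first.
  rewrite -(Lagrange sNG) [(#|N| * _)%N]mulnC.
  apply: (bound _ _ _ _ _ _ (commuting_pairs_normal nsNG)).
  by apply: IHn nsolN; apply: leq_trans (proper_card ltNG) _.
have nsolGN: ~~ solvable (G / N) by rewrite (series_sol nsNG) solN in nsolG.
rewrite -(Lagrange sNG) -card_quotient //.
apply: (bound _ _ _ _ _ _ (commuting_pairs_quotient nsNG)).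
by apply: IHn nsolGN; apply: leq_trans (ltn_quotient ntN sNG) _.
Qed.

(** In a nonsolvable group the order n is at least 30, so the hypothesis yields t/n
    >= 23/60 for the number t of solutions of x^2 = 1. But (t/n)^2 is at most the
    proportion of commuting pairs, and (23/60)^2 > 19/135. *)
Theorem solvable_of_involutory (gT : finGroupType) (G : {group gT}) :
  (5 * #|G| <= 12 * (#|involutory G| + 1))%N -> solvable G.
Proof.
move=> le_t; apply: contraLR isT => nsolG.
have := commuting_pairs_nonsolvable nsolG.
have := sqr_card_involutory_le G.
have := nonsolvable_card_ge30 nsolG.
move=> ge30 le_sq le_cp.
have le_tn: (23 * #|G| <= 60 * #|involutory G|)%N by lia.
have: ((23 * #|G|) ^ 2 <= (60 * #|involutory G|) ^ 2)%N by rewrite leq_exp2r.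
have: (0 < #|G| ^ 2)%N by rewrite expn_gt0 cardG_gt0.
move: le_sq le_cp; rewrite !expnMn; move: (#|G| ^ 2)%N (#|_| ^ 2)%N => n2 t2.
by move: (commuting_pairs G) => s; lia.
Qed.

(** * Noncyclic minimal normal subgroups *)

Section MinNormal.
Variable gT : finGroupType.
Implicit Types (G K V W : {group gT}) (x y v : gT).

Definition inverted V x := [set v in V | v ^ x == v^-1].

Lemma inverted_group_set V x : abelian V -> group_set (inverted V x).
Proof.
move=> abV; apply/group_setP; split=> [|v w]; rewrite !inE.
  by rewrite group1 conj1g invg1 eqxx.
case/andP=> Vv /eqP vx /andP[Vw /eqP wx]; rewrite groupM //=.
by rewrite conjMg vx wx -invMg (centsP abV).
Qed.

Lemma minnormal_sub_eq G V W : minnormal V G ->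
  G \subset 'N(W) -> W \subset V -> W :!=: 1 -> W :=: V.
Proof. by move=> /mingroupP[_ minV] nWG sWV ntW; apply: minV; rewrite ?ntW. Qed.

(** Suppose that every square centralises V. Then G acts on V as an elementary
    abelian 2-group, so for x in G the elements of V inverted by x form a subgroup
    invariant under G. If it is V, then x inverts V. If it is trivial, then x
    centralises V, since v^-1 v^x is inverted by x. Either way x normalises every
    subgroup of V, so that V, being minimal, is cyclic. *)
Lemma minnormal_noncyclic_square G V :
    minnormal V G -> abelian V -> ~~ cyclic V ->
  exists2 y, y \in G & y ^+ 2 \notin 'C(V).
Proof.
move=> minV abV ncycV; have [/andP[ntV nVG] _] := mingroupP minV.
apply/exists_inP; apply: contraR ncycV => /exists_inPn sqC.
have {}sqC y : y \in G -> y ^+ 2 \in 'C(V) by move/sqC; rewrite negbK.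
have memJ v y : v \in V -> y \in G -> v ^ y \in V.
  by move=> Vv Gy; rewrite memJ_norm // (subsetP nVG).
have conjV v y : v \in V -> y \in G -> v ^ y^-1 = v ^ y.
  move=> Vv Gy; apply: (canLR (conjgK _)); rewrite -conjgM -[(y * y)%g]/(y ^+ 2).
  apply/esym/conjg_fixP/commgP/esym; exact: (centP (sqC _ Gy)).
suff act x v : x \in G -> v \in V -> (v ^ x == v) || (v ^ x == v^-1).
  have [v Vv ntv] := trivgPn _ ntV.
  have <- : <[v]> = V; last exact: cycle_cyclic.
  apply: minnormal_sub_eq minV _ _ _; rewrite ?cycle_eq1 ?cycle_subG //.
  apply/subsetP=> x Gx; rewrite inE -cycleJ cycle_subG.
  by case/pred2P: (act x v Gx Vv) => ->; rewrite ?groupV cycle_id.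
move=> Gx Vv; pose W := Group (inverted_group_set x abV).
have sWV: W \subset V by apply/subsetP=> w; rewrite inE => /andP[].
have nWG: G \subset 'N(W).
  apply/subsetP=> g Gg; rewrite inE; apply/subsetP=> _ /imsetP[w Ww ->].
  move: Ww; rewrite !inE => /andP[Vw /eqP wx]; rewrite memJ //=.
  rewrite -conjgM -conjV ?groupM // invMg conjgM (conjV w x) // wx conjV ?groupV //.
  by rewrite conjVg.
have [W1 | ntW] := eqVneq (W : {set gT}) 1; apply/orP; [left | right]; last first.
  by move: Vv; rewrite -(minnormal_sub_eq minV nWG sWV ntW) inE => /andP[].
have: v^-1 * v ^ x \in W.
  rewrite inE groupM ?groupV ?memJ //= conjMg conjVg -(conjV (v ^ x)) ?memJ //.
  by rewrite conjgK (invMg v^-1) invgK eqxx.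
by rewrite W1 => /set1P/eqP; rewrite -eq_mulVg1 eq_sym.
Qed.

(** The cosets y K and y^-1 K are distinct, and no element of either of them has its
    square in K. *)
Lemma card_square_notin G K y : K <| G -> y \in G -> y ^+ 2 \notin K ->
  (2 * #|K| <= #|[set x in G | x ^+ 2 \notin K]|)%N.
Proof.
case/andP=> sKG nKG Gy y2.
have sq z k : z \in G -> k \in K -> (z * k) ^+ 2 \in K -> z ^+ 2 \in K.
  move=> Gz Kk; have -> : (z * k) ^+ 2 = z ^+ 2 * (k ^ z * k).
    by rewrite !expgS !expg0 !mulg1 conjgE !mulgA mulgK.
  by rewrite groupMr // groupM // memJ_norm // (subsetP nKG).
have -> : (2 * #|K| = #|y *: K :|: y^-1 *: K|)%N.
  rewrite cardsU !card_lcoset addnn mul2n.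
  suff -> : y *: K :&: y^-1 *: K = set0 by rewrite cards0 subn0.
  apply/setP=> z; rewrite !inE !mem_lcoset invgK; apply/negP=> /andP[Kz Kz'].
  case/negP: y2; rewrite -(groupMr _ Kz) expgS expg1 -mulgA mulKVg //.
apply: subset_leq_card; apply/subsetP=> z; rewrite !inE => /orP[] /lcosetP[k Kk ->].
  by rewrite groupM ?(subsetP sKG k) //; apply: contra y2; apply: sq.
rewrite groupM ?groupV ?(subsetP sKG k) //; apply: contra y2.
by move/(sq _ _ (groupVr Gy) Kk); rewrite expgVn groupV.
Qed.

Lemma sum_over_cosets G V (f : gT -> nat) : V \subset G ->
  (#|V| * \sum_(x in G) f x = \sum_(x in G) \sum_(v in V) f (x * v)%g)%N.
Proof.
move=> sVG; rewrite exchange_big /= -sum_nat_const; apply: eq_bigr => v Vv.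
rewrite (reindex_inj (mulIg v)) /=; apply: eq_bigl => x.
by rewrite groupMr // (subsetP sVG).
Qed.

(** The solutions v of (x v)^2 = 1 satisfy v^x v = x^-2, so that two of them differ
    by an element inverted by x. *)
Lemma coset_involutory_le V x : abelian V ->
  (#|[set v in V | (x * v)%g ^+ 2 == 1%g]| <= #|inverted V x|)%N.
Proof.
move=> abV; set S := [set v in V | _].
have [-> | [v0]] := set_0Vmem S; first by rewrite cards0.
rewrite inE sqr_mulg => /andP[Vv0 /eqP e0].
rewrite -(card_lcoset (inverted V x) v0); apply: subset_leq_card.
apply/subsetP=> v; rewrite inE sqr_mulg mem_lcoset inE => /andP[Vv /eqP e].
rewrite groupM ?groupV //= conjMg conjVg (invMg v0^-1) invgK.
have conj_eq w : x ^+ 2 * (w ^ x * w) = 1 -> w ^ x = (x ^+ 2)^-1 * w^-1.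
  move=> ew; apply: (mulIg w); apply: (mulgI (x ^+ 2)).
  by rewrite ew mulgKV mulgV.
rewrite (conj_eq v0) // (conj_eq v) // (invMg (x ^+ 2)^-1) !invgK mulgA mulgK.
by rewrite (centsP abV) ?groupV.
Qed.

Lemma proper_card_mul_le p V W : W \subset V -> W :!=: V ->
  (forall q, prime q -> q %| #|V| -> p <= q)%N -> (p * #|W| <= #|V|)%N.
Proof.
move=> sWV neqWV le_p; rewrite -(Lagrange sWV) mulnC leq_mul2l; apply/orP; right.
have gt1: (1 < #|V : W|)%N.
  by rewrite indexg_gt1; apply: contra neqWV => sVW; rewrite eqEsubset sWV.
apply: leq_trans (pdiv_leq _) => //; apply: le_p; first exact: pdiv_prime.
exact: dvdn_trans (pdiv_dvd _) (dvdn_indexg _ _).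
Qed.

(** In a coset x V the proportion of solutions of z^2 = 1 is at most 1/3 unless x
    inverts V, and it is 0 if x^2 does not centralise V. The elements that invert V
    fill at most one coset of the centraliser, while by the preceding lemmas those
    whose square does not centralise V fill at least two; so the average proportion
    is at most 1/3. *)
Lemma odd_minnormal_involutory G V :
    minnormal V G -> V \subset G -> abelian V -> ~~ cyclic V -> odd #|V| ->
  (3 * #|involutory G| <= #|G|)%N.
Proof.
move=> minV sVG abV ncycV oddV; have [/andP[ntV nVG] _] := mingroupP minV.
have [y Gy y2] := minnormal_noncyclic_square minV abV ncycV.
have nsVG: V <| G by apply/andP.
have nsCG: 'C_G(V) <| G by rewrite /normal subsetIl normsI ?normG ?norms_cent.
pose A := [set x in G | inverted V x == V].
pose B := [set x in G | x ^+ 2 \notin 'C_G(V)].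
have leCB: (2 * #|'C_G(V)| <= #|B|)%N.
  by apply: (card_square_notin nsCG Gy); rewrite /= inE (negPf y2) andbF.
have leAC: (#|A| <= #|'C_G(V)|)%N.
  have [-> | [a]] := set_0Vmem A; first by rewrite cards0.
  rewrite inE => /andP[Ga /eqP Va]; rewrite -(card_lcoset 'C_G(V) a).
  apply: subset_leq_card; apply/subsetP=> x; rewrite inE => /andP[Gx /eqP Vx].
  rewrite mem_lcoset inE groupM ?groupV //=; apply/centP=> v Vv.
  apply/esym/commgP/conjg_fixP; rewrite conjgM.
  have inv z w : inverted V z = V -> w \in V -> w ^ z = w^-1.
    by move=> <-; rewrite inE => /andP[_ /eqP].
  have invV w : w \in V -> w ^ a^-1 = w^-1.
    by move=> Vw; apply: (canLR (conjgK _)); rewrite conjVg (inv a) ?invgK.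
  by rewrite invV // (inv x) ?groupV ?invgK.
have pointwise x : x \in G ->
  (3 * #|[set v in V | (x * v)%g ^+ 2 == 1%g]| + #|V| * (x \in B)
    <= #|V| + 2 * #|V| * (x \in A))%N.
  move=> Gx; have le_w := coset_involutory_le x abV.
  have -> : (x \in B) = (x ^+ 2 \notin 'C_G(V)) by rewrite inE Gx.
  have -> : (x \in A) = (inverted V x == V) by rewrite inE Gx.
  have [x2 | /negPn x2] := boolP (x ^+ 2 \notin 'C_G(V)).
    suff -> : [set v in V | (x * v)%g ^+ 2 == 1%g] = set0.
      by rewrite cards0 muln0 muln1 leq_addr.
    apply/setP=> v; rewrite !inE sqr_mulg; apply/negP=> /andP[Vv /eqP e].
    case/negP: x2; apply/setIP; split; first exact: groupX.
    apply: (subsetP abV).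
    rewrite -(groupMr _ (_ : v ^ x * v \in V)) ?e ?group1 //.
    by rewrite groupM // memJ_norm // (subsetP nVG).
  rewrite muln0 addn0; have [Vx | neqV] := eqVneq (inverted V x) V.
    by rewrite muln1 -mulSn leq_mul2l; rewrite Vx in le_w.
  rewrite muln0 addn0; apply: leq_trans (_ : 3 * #|inverted V x| <= _)%N.
    by rewrite leq_mul2l le_w orbT.
  apply: (@proper_card_mul_le _ V (Group (inverted_group_set x abV))) => //.
    by apply/subsetP=> w; rewrite inE => /andP[].
  move=> q pr_q q_dv; rewrite ltn_neqAle prime_gt1 // andbT.
  by apply: contraTneq oddV => q2; rewrite -dvdn2 q2 q_dv.
have card_sum (S : {set gT}) : S \subset G -> (\sum_(x in G) (x \in S) = #|S|)%N.
  move=> sSG; rewrite -sum1_card [RHS]big_mkcond /= [LHS]big_mkcond /=.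
  apply: eq_bigr => x _; have := subsetP sSG x.
  by case: (x \in S) => [->|_] //; case: ifP.
have sumI: (#|V| * #|involutory G|
    = \sum_(x in G) #|[set v in V | (x * v)%g ^+ 2 == 1%g]|)%N.
  rewrite -(card_sum (involutory G)); last by apply/subsetP=> x; rewrite inE => /andP[].
  rewrite (sum_over_cosets _ sVG); apply: eq_bigr => x Gx.
  rewrite -sum1_card [RHS]big_mkcond [LHS]big_mkcond /=.
  apply: eq_bigr => v _; rewrite !inE; case Vv: (v \in V) => //=.
  by rewrite (groupM Gx (subsetP sVG _ Vv)).
have: (\sum_(x in G) (3 * #|[set v in V | (x * v)%g ^+ 2 == 1%g]| + #|V| * (x \in B))
   <= \sum_(x in G) (#|V| + 2 * #|V| * (x \in A)))%N.
  exact: leq_sum.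
have [sAG sBG]: A \subset G /\ B \subset G.
  by split; apply/subsetP=> x; rewrite inE => /andP[].
rewrite !big_split /= -!big_distrr /= -sumI !card_sum //.
have -> : (\sum_(x in G) #|V| = #|G| * #|V|)%N by rewrite sum_nat_const.
move=> le.
have V_gt0 := cardG_gt0 V; rewrite -(leq_pmul2l V_gt0).
have le2: (#|V| * (2 * #|A|) <= #|V| * #|B|)%N.
  rewrite leq_mul2l; apply/orP; right; apply: leq_trans leCB.
  by rewrite leq_mul2l leAC orbT.
move: le le2; move: #|V| #|A| #|B| #|involutory G| #|G|; clear.
by move=> v a b t n; lia.
Qed.
End MinNormal.

Section AbelemTwo.
Variable gT : finGroupType.
Implicit Types (G K V W : {group gT}) (x y v : gT).

(** On average over a coset x V outside the centraliser C of V, the order is at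
    least 3: if the coset contains an involution, then all its elements have order 2
    or 4, and at most half of them have order 2, as x does not centralise V. In C
    the orders are at least 2, except for the identity. *)
Lemma psi_ge_of_abelem2 G V :
    V <| G -> 2.-abelem V ->
  (3 * #|G| <= psi G + #|'C_G(V)| + 1)%N.
Proof.
move=> /andP[sVG nVG] abelV; have abV := abelem_abelian abelV.
have V2 v : v \in V -> v ^+ 2 = 1 by case/(abelemP (p := 2)) : abelV => // _; apply.
(* Orders corrected so that the average is at least 3 on every coset of V. *)
pose f x := (#[x] + (x \in 'C_G(V)) + (x == 1%g))%N.
have sumf : (\sum_(x in G) f x = psi G + #|'C_G(V)| + 1)%N.
  rewrite !big_split /=; congr (_ + _ + _)%N.
    rewrite -sum1_card [RHS]big_mkcond [LHS]big_mkcond /=.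
    by apply: eq_bigr => x _; rewrite in_setI; case: (x \in G) => //=; case: (x \in _).
  rewrite (bigD1 1%g) //= eqxx big1 // => x /andP[_ /negPf->]; by [].
have sVC: V \subset 'C_G(V) by rewrite subsetI sVG.
rewrite -sumf -(leq_pmul2l (cardG_gt0 V)) (sum_over_cosets _ sVG).
have -> : (#|V| * (3 * #|G|) = \sum_(x in G) 3 * #|V|)%N.
  by rewrite sum_nat_const mulnC -mulnA mulnCA.
apply: leq_sum => x Gx; rewrite mulnC -sum_nat_const.
have CxV v : v \in V -> (x * v \in 'C_G(V)) = (x \in 'C_G(V)).
  by move=> Vv; rewrite groupMr // (subsetP sVC).
have [Cx | nCx] := boolP (x \in 'C_G(V)).
  apply: leq_sum => v Vv; rewrite /f CxV // Cx addn1.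
  have [-> | ntxv] := eqVneq (x * v) 1; first by rewrite order1.
  by rewrite addn0 ltnS ltn_neqAle eq_sym order_eq1 ntxv order_gt0.
have ntxv v : v \in V -> x * v != 1.
  by move=> Vv; apply: contraNneq nCx => xv1; rewrite -(CxV v) // xv1 group1.
have le_f v : (#[x * v] <= f (x * v)%g)%N by rewrite /f -addnA leq_addr.
have [/exists_inP[v0 Vv0 /eqP xv0] | /exists_inPn no] :=
    boolP [exists v in V, (x * v) ^+ 2 == 1]; last first.
  by apply: leq_sum => v Vv; apply: leq_trans (le_f v); apply/order_ge3/no.
have memJ v : v \in V -> v ^ x \in V by move=> Vv; rewrite memJ_norm // (subsetP nVG).
have sqV v : v \in V -> (x * v) ^+ 2 \in V.
  move=> Vv; rewrite sqr_mulg (groupMr _ (groupM (memJ _ Vv) Vv)).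
  by rewrite -(groupMr _ (groupM (memJ _ Vv0) Vv0)) -sqr_mulg xv0 group1.
have half: (2 * #|inverted V x| <= #|V|)%N.
  apply: (@proper_card_mul_le _ 2 V (Group (inverted_group_set x abV))).
  - by apply/subsetP=> w; rewrite inE => /andP[].
  - apply: contraNneq nCx => /= VxV; rewrite inE Gx /=; apply/centP=> v Vv.
    apply/esym/commgP/conjg_fixP; move: Vv; rewrite -{1}VxV inE => /andP[Vv /eqP->].
    by apply: (mulgI v); rewrite mulgV -(V2 v Vv) expgS expg1.
  - by move=> q /prime_gt1.
apply: leq_trans (_ : \sum_(v in V) #[x * v] <= _)%N; last exact: leq_sum.
have: (\sum_(v in V) 4 <= \sum_(v in V) (#[x * v] + 2 * ((x * v)%g ^+ 2 == 1%g)))%N.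
  apply: leq_sum => v Vv; case: eqP => [xv2 | /eqP xv2].
    by rewrite (order_eq2 (ntxv v Vv) xv2).
  by rewrite addn0 order_ge4 // (expgM _ 2 2) V2 ?sqV.
have := coset_involutory_le x abV.
rewrite big_split /= -big_distrr /=.
have -> : (\sum_(v in V) ((x * v)%g ^+ 2 == 1%g)
          = #|[set v in V | (x * v)%g ^+ 2 == 1%g]|)%N.
  rewrite -sum1_card [RHS]big_mkcond [LHS]big_mkcond /=.
  by apply: eq_bigr => v _; rewrite inE; case: (v \in V) => //=; case: (_ == _).
rewrite !sum_nat_const; move: half; set s := bigop _ _ _; set w := #|[set _ in V | _]|.
by move: s w #|inverted V x| #|V|; clear=> s w i v; lia.
Qed.
End AbelemTwo.

(** * Groups of order 12 with four Sylow 3-subgroups *)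

Section Tetrahedral.
Variable gT : finGroupType.
Implicit Types (G K P Q V W : {group gT}) (x y v : gT).

(** A characterisation of A_4 up to isomorphism by numbers alone, which makes it
    easy to recognise both an abstract group and the alternating group itself. *)
Definition tetrahedral G := (#|G| == 12) && (#|'Syl_3(G)| == 4).

Definition order3 G := [set x in G | #[x] == 3].

Lemma Syl3_card G Q : #|G| = 12 -> Q \in 'Syl_3(G) -> #|Q| = 3.
Proof. by move=> oG; rewrite inE pHallE oG p_part => /andP[_ /eqP]. Qed.

(** Each of the four Sylow subgroups contributes its two generators. *)
Lemma card_order3 G : tetrahedral G -> #|order3 G| = 8.
Proof.
case/andP=> /eqP oG /eqP oS.
have cycleQ x Q : x \in order3 G -> Q \in 'Syl_3(G) -> (x \in Q) = (<[x]>%G == Q).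
  rewrite inE => /andP[_ /eqP ox] SQ; apply/idP/eqP => [Qx | <-]; last exact: cycle_id.
  by apply/val_inj/eqP; rewrite /= eqEcard cycle_subG Qx -orderE ox (Syl3_card oG SQ).
have Syl_cycle x : x \in order3 G -> <[x]>%G \in 'Syl_3(G).
  rewrite inE => /andP[Gx /eqP ox].
  by rewrite inE pHallE oG p_part cycle_subG Gx -orderE ox.
transitivity (\sum_(Q in 'Syl_3(G)) \sum_(x in order3 G | x \in Q) 1)%N.
  rewrite (exchange_big_dep [in order3 G]) /=; last by move=> Q x _ /andP[].
  rewrite -sum1_card; apply: eq_bigr => x ox.
  rewrite (bigD1 <[x]>%G) /=; last by rewrite Syl_cycle // ox cycle_id.
  rewrite big1 // => Q /andP[/and3P[SQ _ Qx]]; rewrite cycleQ // in Qx.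
  by rewrite eq_sym Qx.
rewrite (eq_bigr (fun _ => 2)) ?sum_nat_const ?oS // => Q SQ.
have oQ := Syl3_card oG SQ; have : #|Q :\ 1| = 2.
  by have := cardsD1 1 Q; rewrite oQ group1 => -[].
rewrite sum1_card => <-; apply: eq_card => x; rewrite unfold_in /= !inE.
apply/andP/andP => [[/andP[_ /eqP ox] Qx] | [ntx Qx]].
  by split=> //; rewrite -order_eq1 ox.
split=> //; have sQG : Q \subset G by move: SQ; rewrite inE => /pHall_sub.
rewrite (subsetP sQG) //=; have := order_dvdG Qx; rewrite oQ.
by rewrite dvdn_divisors // !inE order_eq1 (negPf ntx).
Qed.

Lemma tetrahedral_normaliser G Q :
  tetrahedral G -> Q \in 'Syl_3(G) -> 'N_G(Q) = Q.
Proof.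
case/andP=> /eqP oG /eqP oS SQ; have oQ := Syl3_card oG SQ.
have sylQ : 3.-Sylow(G) Q by rewrite inE in SQ.
apply/esym/eqP; rewrite eqEcard subsetI (pHall_sub sylQ) normG /= oQ.
have := Lagrange (subsetIl G 'N(Q)); rewrite -(card_Syl sylQ) // oS oG.
by case: #|_| => [|[|[|[|n]]]] //; lia.
Qed.

(** Eight elements have order 3, so the other four form the normal Sylow 2-subgroup
    P. It has no element x of order 4: otherwise x^2 would centralise a Sylow
    3-subgroup Q, but Q is its own normaliser. Hence psi(G) = 8 * 3 + 3 * 2 + 1. *)
Lemma tetrahedral_psi G : tetrahedral G -> psi G = 31.
Proof.
move=> tG; have := tG => /andP[/eqP oG /eqP oS].
have [Q SQ] : exists Q, Q \in 'Syl_3(G) by apply/set0Pn; rewrite -card_gt0 oS.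
have NQ := tetrahedral_normaliser tG SQ; have oQ := Syl3_card oG SQ.
have [P sylP] := Sylow_exists 2 G.
have oP : #|P| = 4 by rewrite (card_Hall sylP) oG p_part.
have sPG := pHall_sub sylP.
have s3G : order3 G \subset G by apply/subsetP=> x; rewrite inE => /andP[].
have defP : P :=: G :\: order3 G.
  apply/eqP; rewrite eqEcard cardsD (setIidPr s3G) oG card_order3 // oP andbT.
  apply/subsetP=> x Px; rewrite !inE (subsetP sPG) //= andbT.
  by apply: contraTneq (order_dvdG Px) => ->; rewrite oP.
have nPG : G \subset 'N(P).
  apply/subsetP=> g Gg; rewrite inE defP; apply/subsetP=> _ /imsetP[x + ->].
  by rewrite !inE orderJ groupJr.
have P_order x : x \in P -> x != 1 -> #[x] = 2.
  move=> Px ntx; have := order_dvdG Px; rewrite oP dvdn_divisors // !inE.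
  rewrite order_eq1 (negPf ntx) /= => /orP[/eqP // | /eqP ox].
  have defPx : P :=: <[x]>.
    by apply/esym/eqP; rewrite eqEcard cycle_subG Px oP -orderE ox.
  have ox2 : #[x ^+ 2] = 2 by rewrite orderXdiv ox.
  have nx2 : <[x ^+ 2]> <| G.
    apply: char_normal_trans (_ : P <| G); last by apply/andP.
    by rewrite defPx; apply: cycle_subgroup_char; apply: cycleX.
  suff: x ^+ 2 \in 'N_G(Q).
    by rewrite NQ => /order_dvdG; rewrite ox2 oQ.
  rewrite inE groupX ?(subsetP sPG) //=; apply: (subsetP (cent_sub Q)).
  apply/centP=> q Qq; apply/commgP/conjg_fixP.
  have Gq : q \in G by move: q Qq; apply/subsetP; move: SQ; rewrite inE => /pHall_sub.
  have : (x ^+ 2) ^ q \in <[x ^+ 2]>.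
    by rewrite memJ_norm ?cycle_id // (subsetP (normal_norm nx2)).
  rewrite cycle2g // !inE => /orP[|/eqP //].
  by rewrite conjg_eq1 => /eqP x21; rewrite x21 order1 in ox2.
rewrite /psi (big_setID (order3 G)) /= (setIidPr s3G) -defP.
rewrite (eq_bigr (fun _ => 3)) => [|x]; last by rewrite inE => /andP[_ /eqP].
rewrite sum_nat_const card_order3 // (bigD1 1) //= order1.
rewrite (eq_bigr (fun _ => 2)) => [|x /andP[Px ntx]]; last exact: P_order.
rewrite sum_nat_const; have -> : #|[pred x | (x \in P) && (x != 1)]| = 3.
  have := cardsD1 1 P; rewrite oP group1 => -[->].
  by apply: eq_card => x; rewrite unfold_in !inE andbC.
by [].
Qed.
End Tetrahedral.

(** Needed to compare a group that acts on some of its subgroups with the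
    alternating group on four numbers. *)
Lemma faithful_action_perm (aT : finGroupType) (rT : finType) (G : {group aT})
    (to : {action aT &-> rT}) (S : {set rT}) (n : nat) :
    [acts G, on S | to] -> [faithful G, on S | to] -> S != set0 ->
    #|S| = n ->
  exists f : {morphism G >-> {perm 'I_n}}, 'injm f.
Proof.
move=> actsG faithG ntS; move: n => _ <-.
have actS x g : x \in S -> g \in G -> to x g \in S.
  by move=> Sx Gg; rewrite (acts_act actsG).
have [x0 Sx0] := set0Pn _ ntS.
pose F g : {ffun 'I_#|S| -> 'I_#|S|} := [ffun i => enum_rank_in Sx0 (to (enum_val i) g)].
have F_inj g : g \in G -> injectiveb (F g).
  move=> Gg; apply/injectiveP=> i j; rewrite !ffunE => e.
  have Si := enum_valP i; have Sj := enum_valP j.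
  move: (congr1 enum_val e); rewrite !enum_rankK_in ?actS //.
  by move/act_inj/enum_val_inj.
(* Outside G the map F g need not be injective; the identity is a default value. *)
pose f g : {perm 'I_#|S|} := insubd (1 : {perm 'I_#|S|}) (F g).
have fE g i : g \in G -> enum_val (f g i) = to (enum_val i) g.
  move=> Gg; rewrite -pvalE /f insubdK; last exact: F_inj.
  by rewrite ffunE enum_rankK_in ?actS ?enum_valP.
have fM : {in G &, {morph f : g h / g * h}}.
  move=> g h Gg Gh; apply/permP=> i; apply: enum_val_inj.
  by rewrite permM !fE ?groupM // actM.
exists (Morphism fM); apply/subsetP=> g /setIP[Gg]; rewrite inE => /set1P fg1.
apply: (subsetP faithG); rewrite inE Gg /=; apply/astabP=> x Sx.
by rewrite -(enum_rankK_in Sx0 Sx) -fE // [f g]fg1 perm1.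
Qed.

(** G acts faithfully on its four Sylow 3-subgroups, because each of them is its own
    normaliser. The elements that act as even permutations form a subgroup that
    contains the eight elements of order 3, hence have order 12. *)
Lemma tetrahedral_isog (gT : finGroupType) (G : {group gT}) :
  tetrahedral G -> G \isog 'Alt_('I_4).
Proof.
move=> tG; have := tG => /andP[/eqP oG /eqP oS].
have [Q SQ] : exists Q, Q \in 'Syl_3(G) by apply/set0Pn; rewrite -card_gt0 oS.
have trS := Syl_trans 3 G.
have faith: [faithful G, on 'Syl_3(G) | 'JG].
  rewrite /faithful; set K := 'C_G(_ | _)%g.
  have sKQ R : R \in 'Syl_3(G) -> K \subset R.
    move=> SR; rewrite -(tetrahedral_normaliser tG SR) setIS //.
    apply/subsetP=> g /astabP/(_ R SR)/= e.
    by rewrite inE; move/(congr1 val): e => /= ->.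
  have [R] : exists R, R \in 'Syl_3(G) :\ Q.
    apply/set0Pn; rewrite -card_gt0.
    by have := cardsD1 Q 'Syl_3(G); rewrite oS SQ add1n => -[<-].
  rewrite !inE => /andP[neqRQ SR]; have {}SR : R \in 'Syl_3(G) by rewrite inE.
  have oQ := Syl3_card oG SQ; have oR := Syl3_card oG SR.
  apply: (@subset_trans _ _ (Q :&: R)); first by rewrite subsetI !sKQ.
  rewrite prime_TIg ?oQ //; apply: contra neqRQ => sQR.
  by apply/eqP/val_inj/esym/eqP; rewrite /= eqEcard sQR oQ oR.
have ntS : 'Syl_3(G) != set0 by apply/set0Pn; exists Q.
have [f injf] := faithful_action_perm (atrans_acts trS) faith ntS oS.
have oA : #|'Alt_('I_4)| = 12 by apply: double_inj; rewrite -mul2n card_Alt card_ord.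
suff <- : f @* G = 'Alt_('I_4) by rewrite sub_isog.
apply/eqP; rewrite eqEcard oA card_injm // oG leqnn andbT.
pose M := (f @*^-1 'Alt_('I_4))%G.
suff sGM : G \subset M by rewrite sub_morphim_pre.
have s3M : order3 G \subset M :\ 1.
  apply/subsetP=> x; rewrite inE => /andP[Gx /eqP ox].
  (* Permutations of odd order are even. *)
  have x3 : x ^+ 3 = 1 by rewrite -ox expg_order.
  have Afx : f x \in 'Alt_('I_4).
    have : odd_perm (f x ^+ 3) = false by rewrite -morphX // x3 morph1 odd_perm1.
    by rewrite Alt_even !expgS expg0 mulg1 !odd_permM; case: odd_perm.
  by rewrite in_setD1 (mem_morphpre Gx Afx) -order_eq1 ox.
have le9 : (8 < #|M|)%N.
  by rewrite (cardsD1 1) group1 ltnS -(card_order3 tG) subset_leq_card.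
have sMG : M \subset G := subsetIl _ _.
have : #|M| %| 12 by rewrite -oG cardSg.
rewrite dvdn_divisors // !inE => dvM.
have oM : #|M| = 12.
  by case/or4P: dvM le9 => [/eqP->|/eqP->|/eqP->|/or3P[/eqP->|/eqP->|/eqP->]].
suff <- : M :=: G by [].
by apply/eqP; rewrite eqEcard sMG oG oM.
Qed.

Lemma tetrahedralP (gT : finGroupType) (G : {group gT}) : #|G| = 12 ->
  (forall Q : {group gT}, 3.-Sylow(G) Q -> ~~ (Q <| G)) -> tetrahedral G.
Proof.
move=> oG notN; rewrite /tetrahedral oG /=.
have := card_Syl_mod G (isT : prime 3); have := card_Syl_dvd 3 G.
rewrite oG dvdn_divisors // !inE.
have neq1: #|'Syl_3(G)| != 1%N.
  apply/negP=> /normal_sylowP[Q sylQ nQG].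
  by case/negP: (notN Q sylQ).
by case/or4P=> [|/eqP->|/eqP->|/or3P[/eqP->|/eqP->|/eqP->]] //; rewrite (negPf neq1).
Qed.

(** A normal Sylow 3-subgroup would commute with V, and so its order would divide
    that of the centraliser of V. *)
Lemma tetrahedral_of_self_centralising (gT : finGroupType) (G V : {group gT}) :
  #|G| = 12 -> V <| G -> #|'C_G(V)| = 4 -> #|V| = 4 -> tetrahedral G.
Proof.
move=> oG nsVG oC oV; apply: tetrahedralP => // Q sylQ; apply/negP=> nsQG.
have oQ : #|Q| = 3 by rewrite (card_Hall sylQ) oG p_part.
have coQV : coprime #|Q| #|V| by rewrite oQ oV.
have cQV : Q \subset 'C(V).
  apply/commG1P/trivgP; rewrite -(coprime_TIg coQV) commg_subI //.
    by rewrite subsetI subxx (subset_trans (normal_sub nsQG)) ?normal_norm.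
  by rewrite subsetI subxx (subset_trans (normal_sub nsVG)) ?normal_norm.
have /cardSg : Q \subset 'C_G(V) by rewrite subsetI (normal_sub nsQG).
by rewrite oQ oC.
Qed.

(** A normal Sylow 3-subgroup would contain all 3-cycles; but it is generated by one
    of them, (0 1 2), which fixes the point 3. *)
Lemma tetrahedral_Alt4 : tetrahedral 'Alt_('I_4).
Proof.
apply: tetrahedralP.
  by apply: double_inj; rewrite -mul2n card_Alt card_ord.
move=> Q sylQ; apply/negP=> nsQA.
have oA : #|'Alt_('I_4)| = 12 by apply: double_inj; rewrite -mul2n card_Alt card_ord.
have oQ : #|Q| = 3 by rewrite (card_Hall sylQ) oA p_part.
pose i0 : 'I_4 := inord 0; pose i1 : 'I_4 := inord 1.
pose i2 : 'I_4 := inord 2; pose i3 : 'I_4 := inord 3.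
have neq : [/\ i0 != i1, i0 != i2, i0 != i3 & [/\ i1 != i2, i1 != i3 & i2 != i3]].
  by split; [| | | split]; rewrite -val_eqE /= !inordK.
case: neq => n01 n02 n03 [n12 n13 n23].
have cyc (a b c : 'I_4) : a != b -> a != c -> b != c ->
    (tperm a b * tperm a c) \in Q.
  move=> nab nac nbc; set s := _ * _.
  have s3 : s ^+ 3 = 1.
    (* The product s is the 3-cycle (a b c). *)
    have sa : s a = b by rewrite permM tpermL tpermD // eq_sym.
    have sb : s b = c by rewrite permM tpermR tpermL.
    have sc : s c = a by rewrite permM (tpermD nac nbc) tpermR.
    rewrite !expgS expg0 mulg1; apply/permP=> d; rewrite 2!(permM s) perm1.
    have [->|nda] := eqVneq d a; first by rewrite sa sb sc.
    have [->|ndb] := eqVneq d b; first by rewrite sb sc sa.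
    have [->|ndc] := eqVneq d c; first by rewrite sc sa sb.
    have sd : s d = d by rewrite permM !tpermD // 1?eq_sym.
    by rewrite !sd.
  rewrite (mem_normal_Hall sylQ nsQA) ?Alt_even ?odd_permM ?odd_tperm ?nab ?nac //.
  by rewrite /p_elt; apply: pnat_dvd (_ : #[s] %| 3) _; rewrite ?order_dvdn ?s3.
have ntc : tperm i0 i1 * tperm i0 i2 != 1.
  apply/eqP=> /permP/(_ i0); rewrite permM tpermL perm1 tpermD //; last by rewrite eq_sym.
  by move/eqP; rewrite eq_sym (negPf n01).
have defQ : Q :=: <[tperm i0 i1 * tperm i0 i2]>.
  apply/esym/eqP; rewrite eqEcard cycle_subG cyc //= oQ -orderE.
  have := order_dvdG (cyc _ _ _ n01 n02 n12); rewrite oQ dvdn_divisors // !inE.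
  by rewrite order_eq1 (negPf ntc) => /eqP->.
have := cyc _ _ _ n01 n03 n13; rewrite defQ => /cycleP[k /permP/(_ i3)].
have c3 : (tperm i0 i1 * tperm i0 i2) i3 = i3.
  by rewrite permM (tpermD n03 n13) (tpermD n03 n23).
suff -> : ((tperm i0 i1 * tperm i0 i2) ^+ k) i3 = i3.
  by rewrite permM (tpermD n03 n13) tpermR => /eqP; rewrite (negPf n03).
by rewrite permX; elim: k => //= k ->.
Qed.

(** * Quotients and extensions *)

(** The order of a coset divides the order of each of its elements; the inequality
    is strict at the nontrivial elements of N. *)
Lemma psi_quotient_lt (gT : finGroupType) (G N : {group gT}) :
  N <| G -> N :!=: 1 -> (#|N| * psi (G / N) < psi G)%N.
Proof.
move=> nsNG ntN; have [sNG nNG] := andP nsNG.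
have -> : (#|N| * psi (G / N) = \sum_(x in G) #[coset N x])%N.
  rewrite [RHS](partition_big (coset N) [in G / N]) /=; last first.
    by move=> x Gx; rewrite mem_quotient.
  rewrite /psi big_distrr /=; apply: eq_bigr => _ /morphimP[x Nx Gx ->] /=.
  rewrite (eq_bigr (fun _ => #[coset N x])); last by move=> y /andP[_ /eqP->].
  rewrite sum_nat_const; congr muln; rewrite -(card_rcoset N x).
  apply: eq_card => y; rewrite unfold_in /=; apply/idP/andP.
    move=> Nxy; have Gy : y \in G.
      by case/rcosetP: Nxy => z Nz ->; rewrite groupM // (subsetP sNG).
    by split=> //; apply/eqP/rcoset_kercosetP; rewrite // (subsetP nNG).
  by case=> Gy /eqP/rcoset_kercosetP; apply; rewrite // (subsetP nNG).
have [y Ny nty] := trivgPn _ ntN; have Gy := subsetP sNG y Ny.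
have le_order x : x \in G -> (#[coset N x] <= #[x])%N.
  by move=> Gx; rewrite dvdn_leq // morph_order // (subsetP nNG).
rewrite /psi (bigD1 y) // [ltnRHS](bigD1 y) //= coset_id // order1.
rewrite -addSn leq_add //; first by rewrite ltn_neqAle eq_sym order_eq1 nty order_gt0.
by apply: leq_sum => x /andP[Gx _]; apply: le_order.
Qed.

(** The preimages of the terms of a normal series of G / M, preceded by M and the
    trivial group. *)
Lemma supersolvable_extension (gT : finGroupType) (G M : {group gT}) :
  M <| G -> cyclic M -> supersolvable (G / M)%G -> supersolvable G.
Proof.
move=> nsMG cycM [s ser_s last_s].
pose pre (H : {group coset_of M}) := (coset M @*^-1 H)%G.
have pre1 : pre 1%G = M by apply/val_inj; rewrite /= -kerE ker_coset.
have step (U V : {group coset_of M}) : cyclic_normal_factor (G / M) U V ->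
    cyclic_normal_factor G (pre U) (pre V).
  case/and4P=> nU nV sUV cycUV; have defG := quotientGK nsMG.
  have nsMpre H : M <| pre H.
    by rewrite /normal sub_cosetpre subsetIl.
  apply/and4P; split; rewrite ?morphpreS //.
  - by rewrite -{1}defG cosetpre_normal.
  - by rewrite -{1}defG cosetpre_normal.
  have nUV : pre U <| pre V.
    rewrite cosetpre_normal; apply: normalS sUV _ nU; exact: normal_sub.
  have := third_isog (sub_cosetpre U) (nsMpre V) nUV.
  by rewrite /= !cosetpreK => /isog_cyclic <-.
exists (M :: map pre s); last first.
  have := last_map pre s 1%G; rewrite pre1 last_s /= => ->.
  by apply/val_inj; apply: quotientGK.
apply/andP; split.
  apply/and4P; split; rewrite ?normal1 ?sub1G //=.
  by rewrite -(isog_cyclic (quotient1_isog M)).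
suff pathP U : (cyclic_normal_factor (G / M)%G).-series U s ->
    (cyclic_normal_factor G).-series (pre U) (map pre s).
  by have := pathP _ ser_s; rewrite pre1.
elim: s U {ser_s last_s} => //= V s IHs U /andP[UV ser_s].
by apply/andP; split; [apply: step | apply: IHs].
Qed.

Definition normal_2complement (gT : finGroupType) (G K : {group gT}) :=
  [&& K <| G, odd #|K| & 2.-nat #|G : K|].

Lemma normal_card2_central (gT : finGroupType) (G M : {group gT}) :
  M <| G -> #|M| = 2 -> M \subset 'Z(G).
Proof.
move=> /andP[sMG nMG] oM; rewrite subsetI sMG; apply/subsetP=> m Mm; apply/centP=> g Gg.
have [-> | ntm] := eqVneq m 1; first by apply: commute_sym; apply: commute1.
apply/commgP/conjg_fixP.
have : m ^ g \in M :\ 1 by rewrite !inE conjg_eq1 ntm memJ_norm // (subsetP nMG).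
have [c cM] : exists c, M :\ 1 = [set c].
  by apply/cards1P; have := cardsD1 1 M; rewrite oM group1 add1n => -[<-].
have : m \in M :\ 1 by rewrite !inE ntm.
by rewrite cM !inE => /eqP-> /eqP.
Qed.

(** Let K be the preimage of the 2-complement of G / M. If M has odd order, then so
    does K. If M has order 2, then it is central, K splits over M by the theorem of
    Schur and Zassenhaus, and the complement is characteristic in K. *)
Lemma normal_2complement_extension (gT : finGroupType) (G M : {group gT})
    (Kbar : {group coset_of M}) :
    M <| G -> prime #|M| -> normal_2complement (G / M) Kbar ->
  exists K : {group gT}, normal_2complement G K.
Proof.
move=> nsMG prM /and3P[nsKG oddK ipK].
have [K defK sMK nsK] := inv_quotientN nsMG nsKG.
have nMK : K \subset 'N(M) := subset_trans (normal_sub nsK) (normal_norm nsMG).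
have nsMK : M <| K by apply/andP.
have idx : #|G : K| = #|(G / M)%G : Kbar|.
  by rewrite defK index_quotient_eq ?subIset ?sMK ?orbT ?(normal_sub nsK) ?normal_norm.
have oddKM : odd #|K : M| by rewrite -card_quotient // -defK.
have [oddM | ] := boolP (odd #|M|).
  exists K; apply/and3P; split; rewrite ?idx //.
  by rewrite -(Lagrange sMK) ssrnat.oddM oddM oddKM.
rewrite -dvdn2 dvdn_prime2 // => /eqP oM.
have cMK : K \subset 'C(M).
  have := normal_card2_central nsMG (esym oM); rewrite subsetI => /andP[_].
  by rewrite centsC; apply: subset_trans (normal_sub nsK).
have [L] : exists L, L \in [complements to M in K].
  apply/splitsP; apply: SchurZassenhaus_split => //.
  by rewrite /Hall sMK -oM coprime2n.
case/complP=> tiML defML.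
have sLK : L \subset K by rewrite -defML mulG_subr.
have oK : #|K| = (2 * #|L|)%N by rewrite -defML TI_cardMg // oM.
have oL : #|L| = #|K : M| by rewrite -divgS // oK -oM mulKn.
have iKL : #|K : L| = 2 by rewrite -divgS // oK mulnK.
have nsLK : L <| K.
  rewrite /normal sLK -defML mul_subG ?normG //.
  by apply: cents_norm; rewrite centsC (subset_trans sLK).
have hallL : 2^'.-Hall(K) L by rewrite /pHall sLK /pgroup -odd_2'nat oL oddKM iKL pnatNK.
exists L; apply/and3P; split.
- rewrite -(normal_Hall_pcore hallL nsLK).
  exact: char_normal_trans (pcore_char _ _) nsK.
- by rewrite oL.
- by rewrite -(Lagrange_index (normal_sub nsK) sLK) iKL pnatM idx ipK.
Qed.

(** * Parity of the sum of the orders *)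

Lemma odd_sum_nat (I : finType) (A : {set I}) (f : I -> nat) :
  odd (\sum_(i in A) f i) = odd #|[set i in A | odd (f i)]|.
Proof.
rewrite (eq_bigr (fun i => odd (f i) + 2 * (f i)./2)%N); last first.
  by move=> i _; rewrite mul2n odd_double_half.
rewrite big_split /= -big_distrr /= oddD mul2n odd_double addbF -sum1_card.
congr odd; rewrite big_mkcond [RHS]big_mkcond; apply: eq_bigr => i _.
by rewrite inE; case: (i \in A) => //=; case: odd.
Qed.

Lemma fixfree_involution_even (T : finType) (A : {set T}) (f : T -> T) :
    {in A, involutive f} -> {in A, forall x, f x \in A} ->
    {in A, forall x, f x != x} ->
  ~~ odd #|A|.
Proof.
have [n] := ubnP #|A|; elim: n A => // n IHn A /ltnSE leAn fK fA fx.
have [-> | [x Ax]] := set_0Vmem A; first by rewrite cards0.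
have Afx : f x \in A :\ x by rewrite !inE fx ?fA.
have cardA : #|A| = (#|A :\ x :\ f x|).+2.
  by rewrite (cardsD1 x) Ax (cardsD1 (f x) (A :\ x)) Afx.
rewrite cardA /= negbK; apply: IHn.
- by rewrite cardA in leAn; apply: leq_trans leAn.
- by move=> y /setD1P[_ /setD1P[_ Ay]]; apply: fK.
- move=> y /setD1P[nyfx /setD1P[nyx Ay]]; rewrite !inE fA // andbT; apply/andP; split.
    by apply: contra nyx => /eqP e; rewrite -(fK y Ay) e fK.
  by apply: contra nyfx => /eqP <-; rewrite fK.
- by move=> y /setD1P[_ /setD1P[_ Ay]]; apply: fx.
Qed.

(** Inversion preserves orders, and the identity is the only element of odd order
    that is its own inverse. *)
Lemma odd_psi (gT : finGroupType) (G : {group gT}) : odd (psi G).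
Proof.
rewrite /psi odd_sum_nat; set A := [set x in G | _].
have A1 : 1 \in A by rewrite inE group1 order1.
rewrite (cardsD1 1) A1 add1n /=.
apply: (@fixfree_involution_even _ _ invg) => x; rewrite !inE.
- by rewrite invgK.
- by rewrite groupV orderV invg_eq1.
case/and3P=> ntx Gx oddx; apply: contra ntx => /eqP xV.
rewrite -order_eq1; have : #[x] %| 2 by rewrite order_dvdn expgS expg1 -{1}xV mulVg.
by rewrite dvdn_divisors // !inE => /orP[// | /eqP o2]; rewrite o2 in oddx.
Qed.

(** * Groups with a normal 2-complement of index 4 *)

Section CosetsOfOddNormal.
Variable gT : finGroupType.
Implicit Types (G K : {group gT}) (x y v : gT).

(** For v in K one has y^v = y w with w = (v^-1)^y v, which y inverts. Conversely,
    an inverted w arises in this way from its square root v in K, which exists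
    because K has odd order. *)
Lemma class_inverted K y : y ^+ 2 = 1 -> y \in 'N(K) -> odd #|K| ->
  y ^: K = y *: inverted K y.
Proof.
move=> y2 nKy oddK; have yV := invg_id_of_sqr y2.
have conjy v : y ^ v = y * ((v^-1) ^ y * v) by rewrite !conjgE !mulgA mulgV mul1g.
apply/setP=> z; rewrite mem_lcoset; apply/imsetP/idP=> [[v Kv ->] | ].
  rewrite conjy mulKg inE groupM ?memJ_norm ?groupV //=.
  rewrite conjMg -conjgM -[(y * y)%g]/(y ^+ 2).
  by rewrite y2 conjg1 conjVg (invMg (v ^ y)^-1) invgK.
rewrite inE => /andP[Kw /eqP wy].
have := oddK; set m := #|K| => oddm.
(* The power (m + 1)/2 is the square root of an element whose order divides m. *)
exists ((y^-1 * z) ^+ m./2.+1); first exact: groupX.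
rewrite conjy -expgVn conjXg conjVg wy invgK -expgnDr addnn.
have -> : m./2.+1.*2 = m.+1 by rewrite doubleS -[in RHS](odd_double_half m) oddm.
by rewrite expgS expg_cardG // mulg1 mulKVg.
Qed.

(** The number of inverted elements is the index of the centraliser of y in K, so it
    divides the odd number |K|. *)
Lemma inverted_dichotomy K y : y ^+ 2 = 1 -> y \in 'N(K) -> odd #|K| ->
  inverted K y != K -> (3 * #|inverted K y| <= #|K|)%N.
Proof.
move=> y2 nKy oddK neqK.
have cardI : #|inverted K y| = #|K : 'C_K[y]|.
  by rewrite index_cent1 class_inverted // card_lcoset.
have sIK : inverted K y \subset K by apply/subsetP=> v; rewrite inE => /andP[].
have := Lagrange (subsetIl K 'C[y]); rewrite -cardI /= => cardK.
have neq1 : #|'C_K[y]| != 1%N.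
  apply: contra neqK => /eqP C1; rewrite eqEcard sIK.
  by move: cardK; rewrite C1 mul1n => ->; rewrite leqnn.
have : odd #|'C_K[y]| by move: oddK; rewrite -cardK oddM => /andP[].
move: neq1 (cardG_gt0 'C_K[y]) => /=; rewrite -cardK leq_mul2r orbC.
by case: #|_| => [|[|[|]]].
Qed.

Lemma coset_involutory_dichotomy K x : x \in 'N(K) -> odd #|K| ->
  let S := [set v in K | (x * v) ^+ 2 == 1] in
  S != K -> (3 * #|S| <= #|K|)%N.
Proof.
move=> nKx oddK S neqSK; have [-> | [v0]] := set_0Vmem S; first by rewrite cards0.
rewrite inE => /andP[Kv0 /eqP y2]; set y := x * v0 in y2.
have nKy : y \in 'N(K) by rewrite groupM // (subsetP (normG K)).
have defS : S = v0 *: inverted K y.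
  apply/setP=> v; rewrite mem_lcoset !inE groupMl ?groupV //.
  have [Kv | //] := boolP (v \in K); rewrite /=.
  have -> : x * v = y * (v0^-1 * v) by rewrite /y -mulgA mulKVg.
  rewrite sqr_mulg y2 mul1g; apply/eqP/eqP => [e | ->]; last by rewrite mulVg.
  by apply: (mulIg (v0^-1 * v)); rewrite e mulVg.
rewrite defS card_lcoset; apply: inverted_dichotomy => //.
apply: contra neqSK => /eqP defI; rewrite defS defI.
by rewrite lcoset_id.
Qed.

End CosetsOfOddNormal.

Section FullyInvolutoryCosets.
Variable gT : finGroupType.
Implicit Types (G K : {group gT}) (x y v : gT).

(** An element x such that all of x K solves z^2 = 1 inverts K. If a K and b K are
    two such cosets, then c = a^-1 b centralises K, so c K is a nontrivial coset
    without elements that invert K, as some k in K would otherwise invert K; at most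
    two of the cosets other than K remain. *)
Lemma fully_involutory_cosets G K : K <| G -> odd #|K| -> 1 < #|K| -> #|G : K| = 4 ->
  (#|[set x in G :\: K | [set v in K | (x * v)%g ^+ 2 == 1%g] == K]| <= 2 * #|K|)%N.
Proof.
move=> /andP[sKG nKG] oddK K_gt1 iGK; set G1 := [set x in _ | _].
have inv x v : x \in G1 -> v \in K -> v ^ x = v^-1.
  rewrite inE => /andP[_ /eqP allI] Kv; apply: (mulIg v); rewrite mulVg.
  have /eqP x2 : (x * 1) ^+ 2 == 1.
    by have := group1 K; rewrite -{1}allI inE => /andP[].
  have /eqP : (x * v) ^+ 2 == 1 by move: Kv; rewrite -{1}allI inE => /andP[].
  by rewrite mulg1 in x2; rewrite sqr_mulg x2 mul1g.
have [-> | [a G1a]] := set_0Vmem G1; first by rewrite cards0.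
have [sG1a | /subsetPn[b G1b nab]] := boolP (G1 \subset a *: K).
  apply: leq_trans (subset_leq_card sG1a) _.
  by rewrite card_lcoset leq_pmull.
have sG1 : G1 \subset G :\: K by apply/subsetP=> x; rewrite inE => /andP[].
have Ga : a \in G by case/setDP: (subsetP sG1 a G1a).
have Gb : b \in G by case/setDP: (subsetP sG1 b G1b).
pose c := a^-1 * b; have nKc : c \notin K by rewrite mem_lcoset in nab.
have cc v : v \in K -> v ^ c = v.
  move=> Kv; rewrite conjgM; have -> : v ^ a^-1 = v^-1.
    by apply: (canLR (conjgK _)); rewrite conjVg (inv a) ?invgK.
  by rewrite (inv b) ?groupV ?invgK.
have disj : G1 \subset G :\: (K :|: c *: K).
  apply/subsetP=> x G1x; have := subsetP sG1 x G1x.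
  rewrite !inE => /andP[nKx ->]; rewrite negb_or nKx andbT /=.
  apply: contraTN K_gt1 => /lcosetP[k Kk defx].
  have odd_sq v : v \in K -> v^-1 = v -> v = 1.
    move=> Kv vV; apply/eqP; rewrite -order_eq1.
    have ov : odd #[v] := dvdn_odd (order_dvdG Kv) oddK.
    have : #[v] %| 2 by rewrite order_dvdn expgS expg1 -{1}vV mulVg.
    by rewrite dvdn_divisors // !inE => /orP[// | /eqP o2]; rewrite o2 in ov.
  have invk v : v \in K -> v ^ k = v^-1.
    by move=> Kv; rewrite -(inv x) // defx conjgM cc.
  have k1 : k = 1 by apply: odd_sq => //; rewrite -invk // conjgE mulKg.
  rewrite -leqNgt -trivg_card_le1 -subG1; apply/subsetP=> v Kv; apply/set1P.
  by apply: odd_sq => //; rewrite -invk // k1 conjg1.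
have := subset_leq_card disj; rewrite cardsD.
have -> : G :&: (K :|: c *: K) = K :|: c *: K.
  apply/setIidPr; rewrite subUset sKG /=.
  by apply/subsetP=> _ /lcosetP[k Kk ->]; rewrite groupM ?groupM ?groupV // (subsetP sKG).
have -> : #|K :|: c *: K| = (#|K| + #|K|)%N.
  rewrite cardsU card_lcoset.
  suff -> : K :&: c *: K = set0 by rewrite cards0 subn0.
  apply/setP=> z; rewrite !inE mem_lcoset; apply/negP=> /andP[Kz].
  by rewrite groupMr // groupV (negPf nKc).
rewrite -(Lagrange sKG) iGK; clear; move: #|K| #|G1| => k g; lia.
Qed.

(** Of the three cosets other than K, at most two consist of involutions, and the
    others have at most |K|/3 of them: 1 + 1 + 1/3 = 7/3. *)
Lemma involutory_off_normal_le G K : K <| G -> odd #|K| -> 1 < #|K| -> #|G : K| = 4 ->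
  (3 * #|[set x in G :\: K | (x ^+ 2 == 1)%g]| <= 7 * #|K|)%N.
Proof.
move=> nsKG oddK K_gt1 iGK; have [sKG nKG] := andP nsKG.
have := fully_involutory_cosets nsKG oddK K_gt1 iGK.
set G1 := [set x in _ | _ == _]; set I := [set x in _ | _] => leG1.
pose S x := [set v in K | (x * v) ^+ 2 == 1].
have sumI : (#|K| * #|I| = \sum_(x in G :\: K) #|S x|)%N.
  have -> : #|I| = (\sum_(x in G) (x \in I))%N.
    rewrite -sum1_card [LHS]big_mkcond [RHS]big_mkcond; apply: eq_bigr => x _ /=.
    by rewrite !inE; case: (x \in G); rewrite ?andbF //=; case: (_ && _).
  rewrite (sum_over_cosets _ sKG) [RHS]big_mkcond [LHS]big_mkcond /=.
  apply: eq_bigr => x _; rewrite inE.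
  have [Gx | _] := boolP (x \in G); last by rewrite andbF.
  rewrite andbT; have [Kx | nKx] /= := boolP (x \in K).
    by rewrite big1 // => v Kv; rewrite !inE groupM.
  rewrite -sum1_card [LHS]big_mkcond [RHS]big_mkcond; apply: eq_bigr => v _ /=.
  rewrite !inE; have [Kv | //] := boolP (v \in K).
  by rewrite groupMr // nKx groupM ?(subsetP sKG v) //=; case: (_ == _).
have cardD : #|G :\: K| = (3 * #|K|)%N.
  by rewrite cardsD (setIidPr sKG) -(Lagrange sKG) iGK; clear; lia.
have le : (\sum_(x in G :\: K) 3 * #|S x|
    <= \sum_(x in G :\: K) (#|K| + 2 * #|K| * (x \in G1)))%N.
  apply: leq_sum => x DKx; have Gx : x \in G by case/setDP: DKx.
  have [eqSK | neqSK] := eqVneq (S x) K.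
    have -> : x \in G1 by rewrite inE DKx; apply/eqP.
    by rewrite eqSK muln1 -mulSn.
  have := coset_involutory_dichotomy (subsetP nKG x Gx) oddK neqSK.
  by move/leq_trans; apply; apply: leq_addr.
move: le; rewrite -big_distrr /= -sumI big_split /= -big_distrr /=.
have -> : (\sum_(x in G :\: K) #|K| = 3 * #|K| * #|K|)%N by rewrite sum_nat_const cardD.
have -> : (\sum_(x in G :\: K) (x \in G1) = #|G1|)%N.
  rewrite -sum1_card [LHS]big_mkcond [RHS]big_mkcond; apply: eq_bigr => x _ /=.
  by rewrite !inE; case: (x \in K); case: (x \in G) => //=; case: (_ == _).
move=> le; rewrite -(leq_pmul2l (cardG_gt0 K)); move: le leG1; clear.
by move: #|K| #|G1| #|I| => k g i; nia.
Qed.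
End FullyInvolutoryCosets.

Section NormalTwoComplement.
Variable gT : finGroupType.
Implicit Types (G K V M : {group gT}) (x y v : gT).

Lemma even_order_off G K x : K <| G -> 2.-nat #|G : K| -> x \in G :\: K -> ~~ odd #[x].
Proof.
case/andP=> sKG nKG i2 /setDP[Gx nKx]; apply: contra nKx => oddx.
have nKx := subsetP nKG x Gx; apply: coset_idr => //; apply/eqP; rewrite -order_eq1.
have o2 : 2.-nat #[coset K x].
  by apply: pnat_dvd i2; rewrite -card_quotient // order_dvdG // mem_quotient.
have o2' : 2^'.-nat #[coset K x].
  by rewrite -odd_2'nat; apply: dvdn_odd oddx; apply: morph_order.
by rewrite (pnat_1 o2 o2').
Qed.

(** Let k be the order of K and i the number of involutions of G. If G / K has
    exponent 2, then the elements outside K that are not involutions have order at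
    least 6, and 3i <= 7k. If G / K is cyclic, then they have order at least 4, and
    i <= k. In both cases the sum of the orders exceeds 31k/3 = (31/12)|G|. *)
Lemma psi_normal_2complement_gt G K : K <| G -> odd #|K| -> 1 < #|K| -> #|G : K| = 4 ->
  (31 * #|G| < 12 * psi G)%N.
Proof.
move=> nsKG oddK K_gt1 iGK; have [sKG nKG] := andP nsKG.
have even_off x : x \in G :\: K -> ~~ odd #[x].
  by apply: even_order_off nsKG _; rewrite iGK.
pose I := [set x in G :\: K | (x ^+ 2 == 1)%g].
have cardD : #|G :\: K| = (3 * #|K|)%N.
  by rewrite cardsD (setIidPr sKG) -(Lagrange sKG) iGK; clear; lia.
have psiK : (3 * #|K| <= psi K + 2)%N.
  have := card_le_psi_involutory K; suff -> : #|involutory K| = 1%N by rewrite -addnA.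
  suff -> : involutory K = 1 by rewrite cards1.
  apply/setP=> x; rewrite !inE.
  apply/andP/eqP => [[Kx /eqP x2] | ->]; last by rewrite expg1n.
  apply/eqP; apply: contraLR oddK => ntx; rewrite -dvdn2.
  by rewrite -(order_eq2 ntx x2) order_dvdG.
have psiG : psi G = (psi K + \sum_(x in G :\: K) #[x])%N.
  by rewrite /psi (big_setID K) /= (setIidPr sKG).
have sumI c : (\sum_(x in G :\: K) (c * (x \in I)) = c * #|I|)%N.
  rewrite -big_distrr /= -sum1_card; congr muln.
  rewrite [LHS]big_mkcond [RHS]big_mkcond; apply: eq_bigr => x _ /=.
  by rewrite !inE; case: (x \in K); case: (x \in G) => //=; case: (_ == _).
have cardG : #|G| = (4 * #|K|)%N by rewrite -(Lagrange sKG) iGK mulnC.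
have weigh c : (forall x, x \in G :\: K -> (x ^+ 2 != 1)%g -> (c + 2 <= #[x])%N) ->
    ((c + 2) * (3 * #|K|) <= \sum_(x in G :\: K) #[x] + c * #|I|)%N.
  move=> le_c; rewrite -sumI -big_split /= -cardD mulnC -sum_nat_const.
  apply: leq_sum => x Dx; have -> : (x \in I) = (x ^+ 2 == 1) by rewrite inE Dx.
  have [x2 | x2] := eqVneq (x ^+ 2) 1; last by rewrite muln0 addn0 le_c.
  rewrite order_eq2 ?muln1 1?addnC //.
  by apply: contraTneq Dx => ->; rewrite inE group1.
have [/forall_inP sqK | ] := boolP [forall x in G, x ^+ 2 \in K].
  have le6 : (6 * (3 * #|K|) <= \sum_(x in G :\: K) #[x] + 4 * #|I|)%N.
    (* The order of x is even and at least 3, and it is not 4, as x^2 lies in the group K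
       of odd order. *)
    apply: (weigh 4) => x Dx x2; have Gx : x \in G by case/setDP: Dx.
    have odd2 : odd #[x ^+ 2] := dvdn_odd (order_dvdG (sqK x Gx)) oddK.
    have : #[x] != 4 by apply: contraTneq odd2 => o4; rewrite orderXdiv o4.
    move: (even_off x Dx) (order_ge3 x2); clear.
    by move: #[x] => [|[|[|[|[|[|n]]]]]].
  have := involutory_off_normal_le nsKG oddK K_gt1 iGK; rewrite -/I cardG psiG.
  move: psiK K_gt1 le6; clear; set s := bigop _ _ _.
  by move: (psi K) s #|K| #|I| => p s k i; lia.
rewrite negb_forall_in => /exists_inP[z Gz z2].
have le4 : (4 * (3 * #|K|) <= \sum_(x in G :\: K) #[x] + 2 * #|I|)%N.
  apply: (weigh 2) => x Dx x2; move: (even_off x Dx) (order_ge3 x2); clear.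
  by move: #[x] => [|[|[|[|n]]]].
have leI : (#|I| <= #|K|)%N.
  have := card_square_notin nsKG Gz z2; set B := [set x in G | _] => leB.
  have sIB : I \subset (G :\: K) :\: B.
    apply/subsetP=> x; rewrite !inE => /andP[/andP[nKx Gx] /eqP x2].
    by rewrite Gx nKx x2 group1.
  have sBD : B \subset G :\: K.
    apply/subsetP=> x; rewrite !inE => /andP[Gx nx2]; rewrite Gx andbT.
    by apply: contra nx2 => Kx; rewrite groupX.
  have := subset_leq_card sIB; rewrite cardsD (setIidPr sBD) cardD.
  by move: leB; clear; move: #|K| #|I| #|B| => k i b; lia.
rewrite cardG psiG; move: psiK K_gt1 le4 leI; clear; set s := bigop _ _ _.
by move: (psi K) s #|K| #|I| => p s k i; lia.
Qed.

(** As psi(G) is odd, the equation 12 psi(G) = 31 |G| makes 4 the exact power of 2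
    dividing |G|, which is therefore the index of K. *)
Lemma normal_2complement_psi_neq G K : normal_2complement G K ->
  (12 * psi G != 31 * #|G|)%N.
Proof.
case/and3P=> nsKG oddK i2; apply/negP=> /eqP e; have sKG := normal_sub nsKG.
have log_odd n : odd n -> logn 2 n = 0%N.
  by move=> odd_n; rewrite logn_coprime // coprime2n.
have iGK : #|G : K| = 4.
  rewrite -(part_pnat_id i2) p_part.
  have := congr1 (logn 2) e; rewrite !lognM ?(odd_gt0 (odd_psi G)) //.
  rewrite -(Lagrange sKG) lognM // (log_odd #|K|) // (log_odd (psi G)) ?odd_psi //.
  by rewrite (_ : logn 2 12 = 2) // (_ : logn 2 31 = 0%N) // !add0n addn0 => <-.
have K_gt1 : 1 < #|K|.
  rewrite ltn_neqAle cardG_gt0 andbT; apply: contraPneq e => k1.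
  by rewrite -(Lagrange sKG) iGK -k1; clear; lia.
by have := psi_normal_2complement_gt nsKG oddK K_gt1 iGK; rewrite e ltnn.
Qed.

End NormalTwoComplement.

(** * The dichotomy and the theorem *)

Section Dichotomy.
Variable gT : finGroupType.
Implicit Types (G V : {group gT}).

(** For V not cyclic of odd order p^m, the bounds 5n <= 12(t + 1) and 3t <= n give n
    <= 12, against n >= 2|V| >= 18. For V not cyclic of even order with centraliser
    C, the bounds 12(3n - |C| - 1) <= 31n and 3|C| <= n give n <= 12, while |C| >=
    |V| >= 4; so n = 12 and |C| = |V| = 4. *)
Lemma minnormal_cyclic_or_tetrahedral G V :
    (12 * psi G <= 31 * #|G|)%N -> minnormal V G -> V \subset G ->
  (prime #|V|) \/ tetrahedral G.
Proof.
move=> le_psi minV sVG; have [/andP[ntV nVG] _] := mingroupP minV.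
have nsVG : V <| G by apply/andP.
have le_t : (5 * #|G| <= 12 * (#|involutory G| + 1))%N.
  have := card_le_psi_involutory G; move: le_psi; clear.
  by move: (psi G) #|G| #|involutory G| => p n t; lia.
have [_ _ abelemV] := minnormal_solvable minV sVG (solvable_of_involutory le_t).
have [p pr_p abelV] := is_abelemP abelemV.
have abV := abelem_abelian abelV; have pV := abelem_pgroup abelV.
have [_ p_dvd [m oV]] := pgroup_pdiv pV ntV.
have cycE : cyclic V = (m == 0)%N.
  by rewrite (abelem_cyclic abelV) oV pfactorK // ltnS leqn0.
case: m => [|m] in oV cycE; [by left; rewrite oV expn1 | right].
have ncycV : ~~ cyclic V by rewrite cycE.
have [y Gy y2] := minnormal_noncyclic_square minV abV ncycV.
have le_p2 : (p * p <= #|V|)%N.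
  by rewrite oV !expnS mulnA leq_pmulr // expn_gt0 prime_gt0.
have [p2 | oddp] := even_prime pr_p; last first.
  have oddV : odd #|V| by rewrite oV oddX oddp orbT.
  have neqVG : V :!=: G.
    by apply: contra y2 => /eqP defV; rewrite groupX // (subsetP abV) // defV.
  have le2 : (2 * #|V| <= #|G|)%N by apply: proper_card_mul_le => // q /prime_gt1.
  have le9 : (9 <= p * p)%N by rewrite (@leq_mul 3 3) // odd_prime_gt2.
  have := odd_minnormal_involutory minV sVG abV ncycV oddV.
  move: (leq_trans le9 le_p2) le2 le_t; clear.
  by move: #|V| #|G| #|involutory G| => v n t; lia.
rewrite {p}p2 in pr_p abelV pV oV le_p2 p_dvd *.
have nsCG : 'C_G(V) <| G by rewrite /normal subsetIl normsI ?normG ?norms_cent.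
have y2C : y ^+ 2 \notin 'C_G(V) by rewrite inE (negPf y2) andbF.
have sVC : V \subset 'C_G(V) by rewrite subsetI sVG.
have le3 : (3 * #|'C_G(V)| <= #|G|)%N.
  have := card_square_notin nsCG Gy y2C; set B := [set x in G | _] => leB.
  have sBD : B \subset G :\: 'C_G(V).
    apply/subsetP=> x; rewrite inE => /andP[Gx nx2]; rewrite in_setD Gx andbT.
    by apply: contra nx2; apply: groupX.
  have := subset_leq_card sBD; rewrite cardsD (setIidPr (subsetIl _ _)).
  have := subset_leq_card (subsetIl G 'C(V)); move: leB; clear.
  by move: #|'C_G(V)| #|G| #|B| => c n b; lia.
have := psi_ge_of_abelem2 nsVG abelV; have := subset_leq_card sVC.
move=> leVC le_lower.
have [oG oC oV4] : [/\ #|G| = 12, #|'C_G(V)| = 4 & #|V| = 4].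
  move: le_psi le_p2 le3 leVC le_lower; clear.
  move: (psi G) #|V| #|'C_G(V)| #|G| => s v c n le_psi le_p2 le3 leVC le_lower.
  by split; lia.
exact: tetrahedral_of_self_centralising oG nsVG oC oV4.
Qed.

End Dichotomy.

Lemma supersolvable_trivial (gT : finGroupType) (G : {group gT}) :
  G :=: 1 -> supersolvable G.
Proof. by move=> G1; exists [::] => //=; apply/val_inj. Qed.

(** Passing to the quotient by a minimal normal subgroup of prime order makes the
    inequality strict, which rules out the first alternative there; the second one
    lifts from the quotient. *)
Theorem psi_le_dichotomy (gT : finGroupType) (G : {group gT}) :
    (12 * psi G <= 31 * #|G|)%N ->
  tetrahedral G \/ supersolvable G /\ exists K : {group gT}, normal_2complement G K.
Proof.
have [n] := ubnP #|G|; elim: n => // n IHn in gT G * => /ltnSE leGn le_psi.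
have [G1 | ntG] := eqVneq (G : {set gT}) 1.
  right; split; first exact: supersolvable_trivial.
  by exists G; apply/and3P; rewrite normal_refl indexgg G1 cards1.
have [M minM sMG] := minnormal_exists ntG (normG G).
have [prM | ?] := minnormal_cyclic_or_tetrahedral le_psi minM sMG; [right | by left].
have ntM : M :!=: 1 by rewrite -cardG_gt1 prime_gt1.
have nsMG : M <| G by rewrite /normal sMG; case/andP: (mingroupp minM).
have lt_psi : (12 * psi (G / M) < 31 * #|G / M|)%N.
  rewrite -(ltn_pmul2l (cardG_gt0 M)) [ltnRHS]mulnCA.
  rewrite card_quotient ?normal_norm // Lagrange //; apply: leq_trans le_psi.
  by rewrite mulnCA ltn_pmul2l // psi_quotient_lt.
have [|tG | [superG [Kbar compl]]] := IHn _ (G / M)%G _ (ltnW lt_psi).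
- by apply: leq_trans leGn; apply: ltn_quotient.
- move: lt_psi; rewrite (tetrahedral_psi tG).
  by case/andP: tG => /eqP /= ->.
split; last exact: normal_2complement_extension nsMG prM compl.
exact: supersolvable_extension nsMG (prime_cyclic prM) superG.
Qed.

Import Order.TTheory GRing.Theory Num.Theory.

Lemma psi_isog (gT rT : finGroupType) (G : {group gT}) (H : {group rT}) :
  G \isog H -> psi G = psi H.
Proof.
case/isogP=> f injf <-; rewrite /psi morphimEdom big_imset /=; last exact: injmP.
by apply: eq_bigr => x Gx; rewrite order_injm.
Qed.

Lemma avg_orderE (gT : finGroupType) (G : {group gT}) :
  ((avg_order G < 31%:R / 12%:R)%R = (12 * psi G < 31 * #|G|)%N) *
  ((avg_order G == 31%:R / 12%:R)%R = (12 * psi G == 31 * #|G|)%N).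
Proof.
have n_gt0 : (0 < #|G|%:R :> rat)%R by rewrite ltr0n.
rewrite /avg_order; split.
  rewrite ltr_pdivrMr // mulrAC ltr_pdivlMr // mulrC.
  by rewrite -!natrM ltr_nat.
rewrite eqr_div ?pnatr_eq0 -?lt0n //.
by rewrite -!natrM eqr_nat mulnC.
Qed.

Theorem theorem1p1 (gT : finGroupType) (G : {group gT}) :
  ((avg_order G < 31%:R / 12%:R)%R -> supersolvable G) /\
  ((avg_order G = 31%:R / 12%:R)%R <-> G \isog 'Alt_('I_4)).
Proof.
have tetra_eq (rT : finGroupType) (H : {group rT}) :
    tetrahedral H -> (12 * psi H = 31 * #|H|)%N.
  by move=> tH; rewrite (tetrahedral_psi tH); case/andP: tH => /eqP-> _.
split.
  rewrite avg_orderE => lt_psi; case: (psi_le_dichotomy (ltnW lt_psi)) => [tG | []//].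
  by move: lt_psi; rewrite (tetra_eq _ _ tG) ltnn.
split=> [/eqP | isoG].
  rewrite avg_orderE => /eqP eq_psi.
  have [tG | [_ [K compl]]] := psi_le_dichotomy (eq_leq eq_psi).
    exact: tetrahedral_isog.
  by case/negP: (normal_2complement_psi_neq compl); rewrite eq_psi.
apply/eqP; rewrite avg_orderE (psi_isog isoG) (card_isog isoG).
by rewrite (tetra_eq _ _ tetrahedral_Alt4).
Qed.
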